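(* Let $(A,\cdot)$ be a pre-Malcev algebra, $\alpha:A\to A$ an algebra morphism, $(V,\ell,r)$ a bimodule of $(A,\cdot)$, and $\beta:V\to V$ a linear map such that for all $x\in A$, $b\in V$: $\beta\ell(x)(b)=\ell(\alpha(x))(\beta(b))$ and $\beta r(x)(b)=r(\alpha(x))(\beta(b))$. Define $\widetilde\ell(x)(b)=\ell(\alpha(x))(\beta(b))$ and $\widetilde r(x)(b)=r(\alpha(x))(\beta(b))$. Then $(V,\widetilde\ell,\widetilde r,\beta)$ is a bimodule of the Hom-pre-Malcev algebra $(A,\cdot_\alpha,\alpha)$, where $x\cdot_\alpha y=\alpha(x\cdot y)$.
   Context: All vector spaces are over a field $\mathbb K$ of characteristic $0$. A Hom-pre-Malcev algebra is a triple $(A,\cdot,\alpha)$ with $\cdot$ bilinear, $\alpha:A\to A$ linear with $\alpha(x\cdot y)=\alpha(x)\cdot\alpha(y)$, such that, with $[x,y]=x\cdot y-y\cdot x$, for all $x,y,z,t\in A$: $$[\alpha(y),\alpha(z)]\cdot\alpha(x\cdot t)+[[x,y],\alpha(z)]\cdot\alpha^2(t)+\alpha^2(y)\cdot([x,z]\cdot\alpha(t))-\alpha^2(x)\cdot(\alpha(y)\cdot(z\cdot t))+\alpha^2(z)\cdot(\alpha(x)\cdot(y\cdot t))=0.$$ A pre-Malcev algebra is the case $\alpha=\mathrm{Id}$. A bimodule of a Hom-pre-Malcev algebra $(A,\cdot,\alpha)$ is $(V,\ell,r,\beta)$ with $V$ a vector space, $\ell,r:A\to\mathrm{End}(V)$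 linear, $\beta\in\mathrm{End}(V)$, such that, with $\rho(x)=\ell(x)-r(x)$ and $[x,y]=x\cdot y-y\cdot x$, for all $x,y,z\in A$: (B1) $\beta\ell(x)=\ell(\alpha(x))\beta$, $\beta r(x)=r(\alpha(x))\beta$; (B2) $r(\alpha^2(x))\rho(\alpha(y))\rho(z)-r(\alpha(z)\cdot(y\cdot x))\beta^2+\ell(\alpha^2(y))r(z\cdot x)\beta+\ell(\alpha([z,y]))r(\alpha(x))\beta-\ell(\alpha^2(z))r(\alpha(x))\rho(y)=0$; (B3) $\ell(\alpha^2(y))\ell(\alpha(z))r(x)-r(\alpha^2(x))\rho(\alpha(y))\rho(z)-\ell(\alpha^2(z))r(y\cdot x)\beta-r(\alpha(z\cdot x))\rho(\alpha(y))\beta+r([z,y]\cdot\alpha(x))\beta^2=0$; (B4) $r(\alpha(y)\cdot(z\cdot x))\beta^2+r(\alpha^2(x))\rho([y,z])\beta-\ell(\alpha^2(y))\ell(\alpha(z))r(x)+r(\alpha(y\cdot x))\rho(\alpha(z))\beta+\ell(\alpha^2(z))r(\alpha(x))\rho(y)=0$; (B5) $\ell([[x,y],\alpha(z)])\beta^2-\ell(\alpha^2(x))\ell(\alpha(y))\ell(z)+\ell(\alpha^2(z))\ell(\alpha(x))\ell(y)+\ell(\alpha([y,z]))\ell(\alpha(x))\beta+\ell(\alpha^2(y))\ell([x,z])\beta=0$. A bimodule $(V,\ell,r)$ of a pre-Malcev algebra is the case $\alpha=\mathrm{Id}_A$, $\beta=\mathrm{Id}_V$. For a pre-Malcev algebra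 $(A,\cdot)$ and an endomorphism $\alpha$, $(A,\cdot_\alpha,\alpha)$ is a Hom-pre-Malcev algebra. *)

(* Defs.v *)
From mathcomp Require Import all_boot all_algebra.
Set Implicit Arguments.
Unset Strict Implicit.
Unset Printing Implicit Defensive.
Import GRing.Theory.
Local Open Scope ring_scope.

(* Algebras are not associative and not unital, so a product on a vector space
   is a plain function [A -> A -> A] required to be bilinear, rather than one
   of the library's ring structures. A linear map [A -> End(V)] is uncurried
   as a function [A -> V -> V] required to be bilinear; identities between
   endomorphisms of V are stated at every vector [v]. *)

Section Algebras.
Variables (K : fieldType) (A : lmodType K).

Definition bracket (mul : A -> A -> A) (x y : A) : A := mul x y - mul y x.

Definition algebra_endomorphism (mul : A -> A -> A) (alpha : A -> A) : Prop :=
  GRing.linear_for *:%R alpha /\ {morph alpha : x y / mul x y}.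

Definition hom_pre_malcev_identity (mul : A -> A -> A) (alpha : A -> A) : Prop :=
  let br := bracket mul in
  forall x y z t : A,
    mul (br (alpha y) (alpha z)) (alpha (mul x t))
  + mul (br (br x y) (alpha z)) (alpha (alpha t))
  + mul (alpha (alpha y)) (mul (br x z) (alpha t))
  - mul (alpha (alpha x)) (mul (alpha y) (mul z t))
  + mul (alpha (alpha z)) (mul (alpha x) (mul y t)) = 0.

Record hom_pre_malcev (mul : A -> A -> A) (alpha : A -> A) : Prop :=
  HomPreMalcev {
    hpm_bilinear : bilinear_for *:%R *:%R mul;
    hpm_morphism : algebra_endomorphism mul alpha;
    hpm_identity : hom_pre_malcev_identity mul alpha }.

Definition pre_malcev (mul : A -> A -> A) : Prop := hom_pre_malcev mul id.

Definition twisted_mul (mul : A -> A -> A) (alpha : A -> A) : A -> A -> A :=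
  fun x y => alpha (mul x y).

End Algebras.

Section Bimodules.
Variables (K : fieldType) (A V : lmodType K).
Implicit Types (mul : A -> A -> A) (alpha : A -> A).
Implicit Types (l r : A -> V -> V) (beta : V -> V).

Definition intertwines alpha beta (f : A -> V -> V) : Prop :=
  forall (x : A) (b : V), beta (f x b) = f (alpha x) (beta b).

Definition hom_bimodule_B2 mul alpha l r beta : Prop :=
  let br := bracket mul in
  let rho := fun (x : A) (v : V) => l x v - r x v in
  forall (x y z : A) (v : V),
    r (alpha (alpha x)) (rho (alpha y) (rho z v))
  - r (mul (alpha z) (mul y x)) (beta (beta v))
  + l (alpha (alpha y)) (r (mul z x) (beta v))
  + l (alpha (br z y)) (r (alpha x) (beta v))
  - l (alpha (alpha z)) (r (alpha x) (rho y v)) = 0.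

Definition hom_bimodule_B3 mul alpha l r beta : Prop :=
  let br := bracket mul in
  let rho := fun (x : A) (v : V) => l x v - r x v in
  forall (x y z : A) (v : V),
    l (alpha (alpha y)) (l (alpha z) (r x v))
  - r (alpha (alpha x)) (rho (alpha y) (rho z v))
  - l (alpha (alpha z)) (r (mul y x) (beta v))
  - r (alpha (mul z x)) (rho (alpha y) (beta v))
  + r (mul (br z y) (alpha x)) (beta (beta v)) = 0.

Definition hom_bimodule_B4 mul alpha l r beta : Prop :=
  let br := bracket mul in
  let rho := fun (x : A) (v : V) => l x v - r x v in
  forall (x y z : A) (v : V),
    r (mul (alpha y) (mul z x)) (beta (beta v))
  + r (alpha (alpha x)) (rho (br y z) (beta v))
  - l (alpha (alpha y)) (l (alpha z) (r x v))
  + r (alpha (mul y x)) (rho (alpha z) (beta v))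
  + l (alpha (alpha z)) (r (alpha x) (rho y v)) = 0.

Definition hom_bimodule_B5 mul alpha l beta : Prop :=
  let br := bracket mul in
  forall (x y z : A) (v : V),
    l (br (br x y) (alpha z)) (beta (beta v))
  - l (alpha (alpha x)) (l (alpha y) (l z v))
  + l (alpha (alpha z)) (l (alpha x) (l y v))
  + l (alpha (br y z)) (l (alpha x) (beta v))
  + l (alpha (alpha y)) (l (br x z) (beta v)) = 0.

(* The base [(A, mul, alpha)] is not required here to be a Hom-pre-Malcev
   algebra: that is stated separately wherever this predicate is used. *)
Record hom_bimodule mul alpha l r beta : Prop := HomBimodule {
  hbm_left_bilinear : bilinear_for *:%R *:%R l;
  hbm_right_bilinear : bilinear_for *:%R *:%R r;
  hbm_twist_linear : GRing.linear_for *:%R beta;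
  hbm_B1_left : intertwines alpha beta l;
  hbm_B1_right : intertwines alpha beta r;
  hbm_B2 : hom_bimodule_B2 mul alpha l r beta;
  hbm_B3 : hom_bimodule_B3 mul alpha l r beta;
  hbm_B4 : hom_bimodule_B4 mul alpha l r beta;
  hbm_B5 : hom_bimodule_B5 mul alpha l beta }.

Definition bimodule mul l r : Prop := hom_bimodule mul id l r id.

Definition twisted_action alpha beta (f : A -> V -> V) : A -> V -> V :=
  fun x b => f (alpha x) (beta b).

End Bimodules.

(* Main.v *)
Require Import Defs.
From mathcomp Require Import all_boot all_algebra.
Import GRing.Theory.
Local Open Scope ring_scope.

(** Since [alpha] and [beta] commute with all the operations, each term of a
    twisted identity is the image under [alpha^3] (resp. [beta^3]) of the
    corresponding untwisted term. Pushing the twists down to the variables, the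
    twisted identity is the untwisted one at [alpha^3 x], ..., [beta^3 v]. *)

Lemma linear_for_sub (K : fieldType) (U W : lmodType K) (f : U -> W) :
  GRing.linear_for *:%R f -> {morph f : x y / x - y}.
Proof.
move=> f_lin x y.
(* Linearity is stated on [a *: u + v], so the difference is first brought to the form
   [-1 *: y + x]. *)
by rewrite addrC -scaleN1r f_lin scaleN1r addrC.
Qed.

Lemma twisted_bilinear (K : fieldType) (A V W : lmodType K)
    (mul : A -> V -> W) (gamma : W -> W) :
  GRing.linear_for *:%R gamma -> bilinear_for *:%R *:%R mul ->
  bilinear_for *:%R *:%R (fun x y => gamma (mul x y)).
Proof.
move=> gamma_lin [mul_l mul_r]; split=> u a x y /=.
  by rewrite mul_l gamma_lin.
by rewrite mul_r gamma_lin.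
Qed.

Lemma twisted_action_bilinear (K : fieldType) (A V : lmodType K)
    (alpha : A -> A) (beta : V -> V) (f : A -> V -> V) :
  GRing.linear_for *:%R alpha -> GRing.linear_for *:%R beta ->
  bilinear_for *:%R *:%R f ->
  bilinear_for *:%R *:%R (twisted_action alpha beta f).
Proof.
move=> alpha_lin beta_lin [f_l f_r]; split=> u a x y;
  rewrite /twisted_action /=.
  by rewrite alpha_lin f_l.
by rewrite beta_lin f_r.
Qed.

Lemma twisted_intertwines (K : fieldType) (A V : lmodType K)
    (alpha : A -> A) (beta : V -> V) (f : A -> V -> V) :
  intertwines alpha beta f ->
  intertwines alpha beta (twisted_action alpha beta f).
Proof. by move=> f_tw x b; rewrite /twisted_action f_tw. Qed.

(** This is the Yau twist of the base. The exponent is 3 because, for every variable of every term,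
    the explicit twists and the enclosing products, each contributing one [alpha], add up to
    three. *)
Lemma twisted_hom_pre_malcev (K : fieldType) (A : lmodType K)
    (mul : A -> A -> A) (alpha : A -> A) :
  pre_malcev mul -> algebra_endomorphism mul alpha ->
  hom_pre_malcev (twisted_mul mul alpha) alpha.
Proof.
move=> [mul_bil _ mul_id] [alpha_lin alphaM].
have alphaB := linear_for_sub _ _ _ _ alpha_lin.
split; first exact: twisted_bilinear.
- by split=> // x y; rewrite /twisted_mul alphaM.
move=> x y z t; rewrite /twisted_mul /bracket !(alphaM, alphaB).
(* [mul_id] is the identity with twist [id], so it matches up to conversion. *)
exact: mul_id.
Qed.

Theorem proposition5p2 (K : fieldType) (charK0 : [pchar K] =i pred0)
    (A V : lmodType K)
    (mul : A -> A -> A) (A_pre_malcev : pre_malcev mul)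
    (alpha : A -> A) (alpha_morph : algebra_endomorphism mul alpha)
    (l r : A -> V -> V) (V_bimodule : bimodule mul l r)
    (beta : V -> V) (beta_linear : GRing.linear_for *:%R beta)
    (beta_l : forall (x : A) (b : V), beta (l x b) = l (alpha x) (beta b))
    (beta_r : forall (x : A) (b : V), beta (r x b) = r (alpha x) (beta b)) :
  hom_pre_malcev (twisted_mul mul alpha) alpha /\
  hom_bimodule (twisted_mul mul alpha) alpha
    (twisted_action alpha beta l) (twisted_action alpha beta r) beta.
Proof.
split; first exact: twisted_hom_pre_malcev.
have [alpha_lin alphaM] := alpha_morph.
have alphaB := linear_for_sub _ _ _ _ alpha_lin.
have betaB := linear_for_sub _ _ _ _ beta_linear.
have [l_bil r_bil _ _ _ B2 B3 B4 B5] := V_bimodule.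
split=> //; try exact: twisted_action_bilinear; try exact: twisted_intertwines.
(* Bilinearity and B1 are settled; B2 to B5 remain. *)
all: move=> x y z v; rewrite /twisted_action /twisted_mul /bracket.
(* [rho] and the bracket are differences: [betaB] and [alphaB] split them so that the twists reach
   the single actions and products. *)
all: rewrite !(alphaM, alphaB, betaB, beta_l, beta_r).
- exact: B2.
- exact: B3.
- exact: B4.
- exact: B5.
Qed.
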